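(* Let $\mathcal{G}$ be a hereditary class of bipartite graphs that is weakly-sparse. Then $\mathsf{D}^{\mathrm{Eq}}(\mathcal{G})=O(1)$ if and only if $\mathcal{G}$ has bounded degeneracy.
   Context: A class of bipartite graphs is a set of bipartite graphs (each with a fixed bipartition) closed under isomorphism; it is hereditary if closed under taking induced subgraphs. It is weakly-sparse if there is a constant $t$ such that no graph in it contains $K_{t,t}$ as a (not necessarily induced) subgraph. It has bounded degeneracy if there is a constant $d$ such that every graph in it has a vertex of degree at most $d$. $\mathsf{D}^{\mathrm{Eq}}$: for $M\in\{\pm1\}^{X\times Y}$, $\mathsf{D}^{\mathrm{Eq}}(M)$ is the minimum depth of a rooted binary tree in which each internal node $v$ carries functions $\alpha_v:X\to\mathbb{N}$, $\beta_v:Y\to\mathbb{N}$ and each leaf a value in $\{\pm1\}$, such that for every $(x,y)$, walking from the root (right child if $\alpha_v(x)=\beta_v(y)$, left otherwise) reaches a leaf with value $M(x,y)$. $\mathsf{D}^{\mathrm{Eq}}(\mathcal{G})=O(1)$ means there is a constant $c$ with $\mathsf{D}^{\mathrm{Eq}}(\mathrm{Adj}_G)\le c$ for all $G\in\mathcal{G}$, where $\mathrm{Adj}_G\in\{\pm1\}^{X\times Y}$ is the bipartite adjacency matrix ($1$ iff $xy$ is an edge). *)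

(* Defs.v *)
From HB Require Import structures.
From mathcomp Require Import all_boot.
From mathcomp Require Import boolp.

Set Implicit Arguments.
Unset Strict Implicit.
Unset Printing Implicit Defensive.

(** * Finite bipartite graphs with a fixed bipartition *)

Record bigraph := Bigraph {
  lpart : finType;
  rpart : finType;
  edge : lpart -> rpart -> bool
}.

Definition vertex (G : bigraph) : finType := (lpart G + rpart G)%type.

Definition degree (G : bigraph) (v : vertex G) : nat :=
  match v with
  | inl x => #|[set y : rpart G | edge x y]|
  | inr y => #|[set x : lpart G | edge x y]|
  end.

(* The bipartition is part of the graph: isomorphisms do not swap its sides. *)
Definition isomorphic (G H : bigraph) : Prop :=
  exists (f : lpart G -> lpart H) (g : rpart G -> rpart H),
    [/\ bijective f, bijective g &
        forall x y, edge (f x) (g y) = edge x y].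

Definition induced (G : bigraph) (A : {set lpart G}) (B : {set rpart G}) :
    bigraph :=
  @Bigraph {x : lpart G | x \in A} {y : rpart G | y \in B}
           (fun x y => edge (val x) (val y)).

(* Not necessarily induced.  Only used for H = K_{t,t}, for which ignoring
   embeddings that exchange the two sides makes no difference. *)
Definition subgraph (H G : bigraph) : Prop :=
  exists (f : lpart H -> lpart G) (g : rpart H -> rpart G),
    [/\ injective f, injective g &
        forall x y, edge x y -> edge (f x) (g y)].

Definition biclique (t : nat) : bigraph :=
  @Bigraph 'I_t 'I_t (fun _ _ => true).

(** * Classes of bipartite graphs *)

Definition iso_closed (C : bigraph -> Prop) : Prop :=
  forall G H, isomorphic G H -> C G -> C H.

Definition hereditary (C : bigraph -> Prop) : Prop :=
  forall (G : bigraph) (A : {set lpart G}) (B : {set rpart G}),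
    C G -> C (induced A B).

Definition weakly_sparse (C : bigraph -> Prop) : Prop :=
  exists t : nat, forall G, C G -> ~ subgraph (biclique t) G.

(* The graph without vertices, which lies in every nonempty hereditary class,
   is exempted. *)
Definition bounded_degeneracy (C : bigraph -> Prop) : Prop :=
  exists d : nat, forall G, C G -> 0 < #|vertex G| ->
    exists v : vertex G, degree v <= d.

(** * Deterministic communication complexity with equality queries *)

Inductive sign := Plus | Minus.

Inductive eq_tree (X Y : Type) :=
| Leaf of sign
| Node (alpha : X -> nat) (beta : Y -> nat) (left right : eq_tree X Y).

Arguments Leaf {X Y}.

Fixpoint depth (X Y : Type) (T : eq_tree X Y) : nat :=
  match T with
  | Leaf _ => 0
  | Node _ _ l r => (maxn (depth l) (depth r)).+1
  end.

Fixpoint eval (X Y : Type) (T : eq_tree X Y) (x : X) (y : Y) : sign :=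
  match T with
  | Leaf s => s
  | Node alpha beta l r =>
      if alpha x == beta y then eval r x y else eval l x y
  end.

Definition computes (X Y : Type) (T : eq_tree X Y) (M : X -> Y -> sign) : Prop :=
  forall x y, eval T x y = M x y.

Lemma computable_depth (X Y : finType) (M : X -> Y -> sign) :
  exists k, `[< exists2 T : eq_tree X Y, computes T M & depth T = k >].
Proof.
suff [T HT] : exists T : eq_tree X Y, computes T M.
  by exists (depth T); apply/asboolP; exists T.
have [T HT] : exists T : eq_tree X Y,
    forall x y, x \in enum X -> eval T x y = M x y.
  elim: (enum X) => [|x0 s [T HT]]; first by exists (Leaf Plus).
  exists (Node (fun x => (x != x0) : nat) (fun=> 0) T
            (Node (fun=> 0) (fun y => if M x0 y is Plus then 0 else 1)
              (Leaf Minus) (Leaf Plus))) => x y.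
  rewrite inE /=; case: eqP => [->|_] /=; last exact: HT.
  by case: (M x0 y).
by exists T => x y; apply: HT; rewrite mem_enum.
Qed.

Definition DEq (X Y : finType) (M : X -> Y -> sign) : nat :=
  ex_minn (computable_depth M).

Definition Adj (G : bigraph) (x : lpart G) (y : rpart G) : sign :=
  if edge x y then Plus else Minus.

Definition DEq_bounded (C : bigraph -> Prop) : Prop :=
  exists c : nat, forall G, C G -> DEq (@Adj G) <= c.

(* Main.v *)
Require Import Defs.
From mathcomp Require Import all_boot boolp.

Set Implicit Arguments.
Unset Strict Implicit.
Unset Printing Implicit Defensive.

(** If every induced subgraph has a vertex of degree at most d, the edges can be
    oriented so that all out-degrees are at most d, and 2d equality queries test
    whether one of x, y is an out-neighbour of the other.

    Conversely, a tree of bounded depth covers the edges by boundedly many sets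
    F, each of which splits, along the queries answered positively, into blocks
    A * B on which F is the complement of k relations [alpha x = beta y].  Among
    sufficiently many columns of B there is a large set U on which every beta is
    constant or injective; a row meeting U then misses at most k of its elements,
    so fewer than t rows meet U, as F has no K_{t,t}.  Removing such sets U one
    after the other shows that F has O(|A| + |B|) edges, so the graph has a
    vertex of bounded degree. *)

(** * Large sets of columns on which each function is constant or injective *)

Definition edges_in (X Y : finType) (F : X -> Y -> bool)
    (A : {set X}) (B : {set Y}) : nat :=
  \sum_(x in A) \sum_(y in B) F x y.

Definition biclique_free (X Y : finType) (t : nat) (E : X -> Y -> bool) : Prop :=
  forall (A : {set X}) (B : {set Y}), t <= #|A| -> t <= #|B| ->
    exists x y, [/\ x \in A, y \in B & ~~ E x y].

(** [n] records the queries answered negatively on the way from the root to a node. *)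
Definition avoids (X Y : Type) (n : seq ((X -> nat) * (Y -> nat)))
    (x : X) (y : Y) : bool :=
  all (fun q => q.1 x != q.2 y) n.

Definition const_or_inj (Y : finType) (U : {set Y}) (f : Y -> nat) : Prop :=
  (exists v, {in U, forall y, f y = v}) \/ {in U &, injective f}.

Lemma const_or_inj_sub (Y : finType) (U V : {set Y}) (f : Y -> nat) :
  U \subset V -> const_or_inj V f -> const_or_inj U f.
Proof.
move=> /subsetP sUV [[v fv]|f_inj]; [left; exists v|right].
- by move=> y /sUV; apply: fv.
- by move=> y z /sUV yV /sUV zV; apply: f_inj.
Qed.

(** Partition [B] into the level sets of [f]. If there are at least [m], a transversal is injective;
    otherwise one of them has [m] elements, as fewer than [m] classes of at most [m] elements cannot
    fill [B]. *)
Lemma large_const_or_inj1 (Y : finType) (m : nat) (f : Y -> nat) (B : {set Y}) :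
  m ^ 2 <= #|B| ->
  exists U : {set Y}, [/\ U \subset B, m <= #|U| & const_or_inj U f].
Proof.
move=> leB; pose P := preim_partition f B.
have partP : partition P B := preim_partitionP f B.
have [leP|ltP] := leqP m #|P|.
  exists (transversal P B); have trP := transversalP partP.
  have sUB := transversal_sub trP.
  split=> //; first by rewrite (card_transversal trP).
  right=> y z yU zU fyz.
  have yB := subsetP sUB _ yU; have zB := subsetP sUB _ zU.
  apply: (pblock_inj trP yU zU); apply/eqP.
  rewrite eq_pblock ?(partition_trivIset partP) //.
    rewrite /P /preim_partition pblock_equivalence_partition ?fyz //.
    by split=> // /eqP->.
  by rewrite (cover_partition partP).
have [/exists_inP[V VP leV]|noV] := boolP [exists V in P, m <= #|V|].
  exists V; split=> //; first by rewrite -(cover_partition partP) bigcup_sup.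
  left; have /set0Pn[z zV]: V != set0 by exact: partition_neq0 partP VP.
  exists (f z) => y yV.
  have tiP := partition_trivIset partP.
  have cV u : u \in V -> u \in B.
    by move=> uV; rewrite -(cover_partition partP); apply/bigcupP; exists V.
  have: y \in pblock P z by rewrite (def_pblock tiP VP zV).
  rewrite /P /preim_partition pblock_equivalence_partition ?cV //.
    by move/eqP.
  by split=> // /eqP->.
have := leB; rewrite (card_partition partP) leqNgt; case/negP.
have m_gt0 : 0 < m by case: (m) ltP.
apply: (@leq_ltn_trans (#|P| * m)).
  rewrite -sum_nat_const leq_sum // => V VP.
  by move/exists_inPn: noV => /(_ V VP); rewrite -ltnNge => /ltnW.
by rewrite -mulnn ltn_pmul2r.
Qed.

(** Each function costs a square root of the size, hence the iterated exponent. *)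
Lemma large_const_or_inj (Y : finType) (m : nat) (fs : seq (Y -> nat))
    (B : {set Y}) :
  m ^ (2 ^ size fs) <= #|B| ->
  exists U : {set Y}, [/\ U \subset B, m <= #|U| &
    forall i, i < size fs -> const_or_inj U (nth (fun=> 0) fs i)].
Proof.
elim: fs B => [|f fs IH] B /=; first by rewrite expn1 => leB; exists B.
rewrite expnSr expnM => /(large_const_or_inj1 f)[V [sVB leV ciV]].
have [U [sUV leU ciU]] := IH V leV.
exists U; split=> [||[|i]] //; first exact: subset_trans sUV sVB.
  by move=> _; apply: const_or_inj_sub ciV.
exact: ciU.
Qed.

(** * Edge bound for the complement of finitely many equality relations *)

(** A constant function differs from [a x] at [z], hence on all of [U], and excludes no column; an
    injective one takes the value [a x] at most once. *)
Lemma missed_le_size (X Y : finType) (n : seq ((X -> nat) * (Y -> nat)))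
    (U : {set Y}) (x : X) (z : Y) :
  (forall i, i < size n -> const_or_inj U (nth (fun=> 0) (map snd n) i)) ->
  z \in U -> avoids n x z -> #|[set y in U | ~~ avoids n x y]| <= size n.
Proof.
move=> + zU; elim: n => [|[a b] n IH] /= ciU.
  by move=> _; rewrite leqn0 cards_eq0; apply/eqP/setP => y; rewrite !inE andbF.
case/andP=> abz avz.
have -> : [set y in U | ~~ ((a x != b y) && avoids n x y)] =
    [set y in U | a x == b y] :|: [set y in U | ~~ avoids n x y].
  by apply/setP => y; rewrite !inE negb_and negbK andb_orr.
apply: leq_trans (leq_card_setU _ _) _; rewrite -add1n leq_add //; last first.
  by apply: IH => // i lti; apply: (ciU i.+1).
case: (ciU 0 (ltn0Sn _)) => /= [[v bv]|b_inj].
  rewrite (_ : [set _ in _ | _] = set0) ?cards0 //.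
  apply/setP => y; rewrite !inE; apply/negP => /andP[yU].
  by rewrite (bv y yU) -(bv z zU) (negbTE abz).
apply/card_le1_eqP => y y'; rewrite !inE => /andP[yU /eqP ey] /andP[yU' /eqP ey'].
by apply: b_inj => //; rewrite -ey -ey'.
Qed.

Lemma card_bigcup_le (I T : finType) (P : pred I) (F : I -> {set T}) :
  #|\bigcup_(i | P i) F i| <= \sum_(i | P i) #|F i|.
Proof.
apply: (big_ind2 (fun (S : {set T}) m => #|S| <= m)) => //.
  by rewrite cards0.
move=> S1 m1 S2 m2 le1 le2; apply: leq_trans (leq_card_setU _ _) _.
exact: leq_add.
Qed.

(** Any [t] rows meeting [U] miss together at most [t * size n] of its columns, so [t] columns
    remain that are joined to all of them, a biclique in [E]. *)
Lemma few_rows_meet (X Y : finType) (t : nat) (n : seq ((X -> nat) * (Y -> nat)))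
    (E : X -> Y -> bool) (A : {set X}) (U : {set Y}) :
  biclique_free t E ->
  {in A & U, forall x y, avoids n x y -> E x y} ->
  (forall i, i < size n -> const_or_inj U (nth (fun=> 0) (map snd n) i)) ->
  t + t * size n <= #|U| ->
  #|[set x in A | [exists y in U, avoids n x y]]| <= t.
Proof.
move=> freeE sub ciU leU; rewrite leqNgt; apply/negP => /ltnW leR.
(* Exactly [t] rows are kept, since each further row could lose more columns. *)
have [R [sR cR]] : exists R : {set X},
    R \subset [set x in A | [exists y in U, avoids n x y]] /\ #|R| = t.
  have := card_geqP leR => -[s [us ss sub_s]].
  exists [set x in s]; split; last by rewrite cardsE (card_uniqP us).
  by apply/subsetP => x; rewrite inE => /sub_s.
pose V := [set y in U | [forall x in R, avoids n x y]].
have inR x : x \in R -> x \in A /\ exists2 z, z \in U & avoids n x z.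
  by move/(subsetP sR); rewrite inE => /andP[-> /exists_inP].
have leD : #|U :\: V| <= t * size n.
  have sD : U :\: V \subset \bigcup_(x in R) [set y in U | ~~ avoids n x y].
    apply/subsetP => y; rewrite !inE => /andP[+ yU].
    rewrite yU => /forall_inPn[x xR nav].
    by apply/bigcupP; exists x => //; rewrite inE yU.
  apply: leq_trans (subset_leq_card sD) _.
  apply: leq_trans (card_bigcup_le _ _) _; rewrite -cR -sum_nat_const.
  apply: leq_sum => x /inR[_ [z zU av]].
  exact: missed_le_size zU av.
have sVU : V \subset U by apply/subsetP => y; rewrite inE => /andP[].
have leV : t <= #|V|.
  rewrite -(leq_add2r (t * size n)); apply: leq_trans leU _.
  by rewrite -(cardsID V U) (setIidPr sVU) leq_add2l.
have [|x [y [xR yV]]] := freeE R V _ leV; first by rewrite cR.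
case/negP; have [xA _] := inR x xR.
move: yV; rewrite inE => /andP[yU /forall_inP/(_ x xR)].
exact: sub.
Qed.

(** The number of columns that guarantees a set [U] of size [(t + t * k).+1] for [k] functions. The
    successor keeps [U] nonempty even for [t = 0], so that removing it makes progress. *)
Definition leaf_bound (t k : nat) : nat := (t + t * k).+1 ^ (2 ^ k).

Lemma leaf_bound_ge (t k : nat) : t <= leaf_bound t k.
Proof.
rewrite /leaf_bound; apply: (@leq_trans ((t + t * k).+1 ^ 1)).
  by rewrite expn1 ltnW // ltnS leq_addr.
by rewrite leq_pexp2l // expn_gt0.
Qed.

Lemma edges_in_avoids (X Y : finType) (t : nat)
    (n : seq ((X -> nat) * (Y -> nat))) (E : X -> Y -> bool)
    (A : {set X}) (B : {set Y}) :
  biclique_free t E ->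
  {in A & B, forall x y, avoids n x y -> E x y} ->
  edges_in (avoids n) A B <= leaf_bound t (size n) * (#|A| + #|B|).
Proof.
move=> freeE; have [b leb] := ubnP #|B|; elim: b B leb => // b IH B leb sub.
(* With few columns, every row has at most [leaf_bound] edges. *)
have [ltB|leB] := ltnP #|B| (leaf_bound t (size n)).
  apply: (@leq_trans (\sum_(x in A) leaf_bound t (size n))).
    apply: leq_sum => x _; apply: leq_trans (ltnW ltB).
    by rewrite -sum1_card leq_sum // => y _; case: avoids.
  by rewrite sum_nat_const mulnC leq_mul2l leq_addr orbT.
have [U [sUB leU ciU]] : exists U : {set Y},
    [/\ U \subset B, (t + t * size n).+1 <= #|U| &
    forall i, i < size n -> const_or_inj U (nth (fun=> 0) (map snd n) i)].
  have := @large_const_or_inj Y (t + t * size n).+1 (map snd n) B.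
  by rewrite size_map; apply.
have subU : {in A & U, forall x y, avoids n x y -> E x y}.
  by move=> x y xA /(subsetP sUB); apply: sub.
have le_rows := few_rows_meet freeE subU ciU (ltnW leU).
have cB : #|B| = #|U| + #|B :\: U| by rewrite -(cardsID U B) (setIidPr sUB).
(* Only the at most [t] rows that meet [U] contribute, each at most [#|U|]. *)
have leU' : edges_in (avoids n) A U <= leaf_bound t (size n) * #|U|.
  apply: (@leq_trans (\sum_(x in [set x in A | [exists y in U, avoids n x y]])
                        #|U|)).
    rewrite /edges_in (bigID (fun x => [exists y in U, avoids n x y])) /=.
    rewrite [X in _ + X]big1 ?addn0.
      under [leqRHS]eq_bigl do rewrite inE.
      apply: leq_sum => x _.
      by rewrite -sum1_card leq_sum // => y _; case: avoids.
    move=> x /andP[_ /exists_inPn noU]; apply: big1 => y yU.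
    by rewrite (negbTE (noU y yU)).
  rewrite sum_nat_const leq_mul2r; apply/orP; right.
  exact: leq_trans le_rows (leaf_bound_ge _ _).
have -> : edges_in (avoids n) A B =
    edges_in (avoids n) A U + edges_in (avoids n) A (B :\: U).
  rewrite /edges_in -big_split; apply: eq_bigr => x _.
  by rewrite (big_setID U) (setIidPr sUB).
rewrite cB addnCA mulnDr leq_add // IH //.
  rewrite -ltnS; apply: leq_trans leb.
  by rewrite ltnS cB -add1n leq_add2r (leq_trans _ leU).
by move=> x y xA /setDP[yB _]; apply: sub.
Qed.

(** * Edge bound along an equality tree *)

(** Blocks for distinct values [v] share neither rows nor columns, so their sizes add up to at most
    [#|A| + #|B|]: linear bounds survive a positive answer with the same constant. *)
Lemma edges_in_blocks (X Y : finType) (F : X -> Y -> bool) (K : nat)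
    (a : X -> nat) (b : Y -> nat) (A : {set X}) (B : {set Y}) :
  (forall v, edges_in F [set x in A | a x == v] [set y in B | b y == v] <=
     K * (#|[set x in A | a x == v]| + #|[set y in B | b y == v]|)) ->
  edges_in (fun x y => (a x == b y) && F x y) A B <= K * (#|A| + #|B|).
Proof.
(* [M] bounds all values of [a] and [b], so that ['I_M.+1] indexes the blocks. *)
move=> leK; pose M := \max_x a x + \max_y b y.
have leA x : a x < M.+1 by rewrite ltnS (leq_trans (leq_bigmax x)) ?leq_addr.
have leB y : b y < M.+1 by rewrite ltnS (leq_trans (leq_bigmax y)) ?leq_addl.
have eA x (v : 'I_M.+1) : (inord (a x) == v) = (a x == v).
  by rewrite -val_eqE /= inordK.
have eB y (v : 'I_M.+1) : (inord (b y) == v) = (b y == v).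
  by rewrite -val_eqE /= inordK.
have cA : #|A| = \sum_(v < M.+1) #|[set x in A | a x == v]|.
  rewrite -sum1_card (partition_big (fun x => inord (a x) : 'I_M.+1) predT) //=.
  apply: eq_bigr => v _; rewrite -sum1_card; apply: eq_bigl => x.
  by rewrite inE eA.
have cB : #|B| = \sum_(v < M.+1) #|[set y in B | b y == v]|.
  rewrite -sum1_card (partition_big (fun y => inord (b y) : 'I_M.+1) predT) //=.
  apply: eq_bigr => v _; rewrite -sum1_card; apply: eq_bigl => y.
  by rewrite inE eB.
rewrite cA cB -big_split big_distrr /=.
rewrite /edges_in (partition_big (fun x => inord (a x) : 'I_M.+1) predT) //=.
apply: leq_sum => v _; apply: leq_trans (leK v).
rewrite /edges_in [leqLHS](eq_bigl (fun x => x \in [set x in A | a x == v])).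
  apply: leq_sum => x; rewrite inE => /andP[_ /eqP->].
  rewrite (bigID (fun y => b y == v)) /= [X in _ + X]big1 ?addn0.
    rewrite [leqRHS](eq_bigl (fun y => (y \in B) && (b y == v))) => [|y].
      by apply: leq_sum => y _; case: (_ == _); case: (F _ _).
    by rewrite inE.
  by move=> y /andP[_ /negbTE]; rewrite eq_sym => ->.
by move=> x; rewrite inE eA.
Qed.

Definition is_plus (s : sign) : bool := if s is Plus then true else false.

(** [d] is the remaining depth and [k] the number of negative answers so far; only the left branch
    increases [k]. The summand [leaf_bound t k] at every level serves leaves reached before the
    depth is used up. *)
Fixpoint tree_bound (t d k : nat) : nat :=
  leaf_bound t k +
  if d is d'.+1 then tree_bound t d' k.+1 + tree_bound t d' k else 0.

(** Induction on the tree: a negative answer extends [n], a positive one restricts [A] and [B] to a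
    block on which both sides of the query have the same value. This is why containment in [E] is
    required on [A] and [B] only. *)
Lemma edges_in_tree (X Y : finType) (t d : nat) (T : eq_tree X Y)
    (n : seq ((X -> nat) * (Y -> nat))) (E : X -> Y -> bool)
    (A : {set X}) (B : {set Y}) :
  biclique_free t E -> depth T <= d ->
  {in A & B, forall x y, avoids n x y -> is_plus (eval T x y) -> E x y} ->
  edges_in (fun x y => avoids n x y && is_plus (eval T x y)) A B <=
  tree_bound t d (size n) * (#|A| + #|B|).
Proof.
move=> freeE; elim: T d n A B => [[]|a b l IHl r IHr] [|d] n A B //= leT sub;
  rewrite ?mulnDl.
- apply: leq_trans (leq_addr _ _); rewrite /edges_in.
  under eq_bigr do under eq_bigr do rewrite andbT.
  by apply: edges_in_avoids freeE _ => x y xA yB av; apply: sub.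
- apply: leq_trans (leq_addr _ _); rewrite /edges_in.
  under eq_bigr do under eq_bigr do rewrite andbT.
  by apply: edges_in_avoids freeE _ => x y xA yB av; apply: sub.
- by rewrite /edges_in big1 // => x _; rewrite big1 // => y _; rewrite andbF.
- by rewrite /edges_in big1 // => x _; rewrite big1 // => y _; rewrite andbF.
move: leT; rewrite ltnS geq_max => /andP[leTl leTr].
apply: leq_trans (leq_addl _ _).
set F := fun x y => avoids ((a, b) :: n) x y && is_plus (eval l x y).
set H := fun x y => (a x == b y) && (avoids n x y && is_plus (eval r x y)).
have -> : edges_in (fun x y => avoids n x y &&
    is_plus (if a x == b y then eval r x y else eval l x y)) A B =
    edges_in F A B + edges_in H A B.
  rewrite /edges_in -big_split; apply: eq_bigr => x _.
  rewrite -big_split; apply: eq_bigr => y _.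
  by rewrite /F /H /=; case: (a x == b y); rewrite /= ?addn0.
apply: leq_add.
  apply: (IHl d ((a, b) :: n)) => // x y xA yB /= /andP[/negbTE nab av] pl.
  by apply: sub => //; rewrite nab.
apply: edges_in_blocks => v; apply: IHr => // x y.
rewrite !inE => /andP[xA /eqP ax] /andP[yB /eqP bv] av pr.
by apply: sub => //; rewrite ax bv eqxx.
Qed.

(** * From few edges to a vertex of low degree *)

Lemma biclique_freeP (G : bigraph) (t : nat) :
  ~ subgraph (biclique t) G -> biclique_free t (@edge G).
Proof.
move=> noK A B leA leB; apply: contrapT => noE; apply: noK.
exists (fun i : 'I_t => enum_val (widen_ord leA i)).
exists (fun i : 'I_t => enum_val (widen_ord leB i)).
split=> [i j /enum_val_inj /(congr1 val) /= /val_inj //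
        |i j /enum_val_inj /(congr1 val) /= /val_inj //|i j _].
apply: contrapT => /negP nE; apply: noE.
by do 2!eexists; split; [| |exact: nE]; apply: enum_valP.
Qed.

Lemma DEq_le (X Y : finType) (M : X -> Y -> sign) (T : eq_tree X Y) :
  computes T M -> DEq M <= depth T.
Proof.
move=> TM; rewrite /DEq; case: ex_minnP => k _; apply.
by apply/asboolP; exists T.
Qed.

Lemma DEq_tree (X Y : finType) (M : X -> Y -> sign) :
  exists2 T : eq_tree X Y, computes T M & depth T = DEq M.
Proof. by rewrite /DEq; case: ex_minnP => k /asboolP. Qed.

Lemma card_edges_le (G : bigraph) (t : nat) :
  ~ subgraph (biclique t) G ->
  edges_in (@edge G) setT setT <=
  tree_bound t (DEq (@Adj G)) 0 * (#|lpart G| + #|rpart G|).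
Proof.
move=> /biclique_freeP freeE; have [T compT depT] := DEq_tree (@Adj G).
have eT x y : is_plus (eval T x y) = edge x y.
  by rewrite compT /Adj; case: edge.
have := @edges_in_tree _ _ t _ T [::] _ setT setT freeE (leqnn _).
rewrite depT !cardsT /edges_in.
under eq_bigr do under eq_bigr do rewrite /= eT.
by apply=> x y _ _ _; rewrite eT.
Qed.

Lemma edges_in_degree_l (G : bigraph) :
  edges_in (@edge G) setT setT = \sum_x degree (inl x : vertex G).
Proof.
rewrite /edges_in; under eq_bigl do rewrite inE.
apply: eq_bigr => x _; rewrite /= -sum1_card [RHS]big_mkcond.
by apply: eq_big => y; rewrite !inE // => _; case: edge.
Qed.

Lemma edges_in_degree_r (G : bigraph) :
  edges_in (@edge G) setT setT = \sum_y degree (inr y : vertex G).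
Proof.
rewrite /edges_in exchange_big; under eq_bigl do rewrite inE.
apply: eq_bigr => y _; rewrite /= -sum1_card [RHS]big_mkcond.
by apply: eq_big => x; rewrite !inE // => _; case: edge.
Qed.

Lemma exists_low_degree (G : bigraph) (K : nat) :
  edges_in (@edge G) setT setT <= K * (#|lpart G| + #|rpart G|) ->
  0 < #|vertex G| -> exists v : vertex G, degree v <= K.*2.
Proof.
move=> leE; rewrite card_sum => V_gt0; apply: contrapT => noV.
have gtK v : K.*2 < degree (v : vertex G).
  by rewrite ltnNge; apply/negP => lev; apply: noV; exists v.
have leX : K.*2.+1 * #|lpart G| <= edges_in (@edge G) setT setT.
  by rewrite edges_in_degree_l mulnC -sum_nat_const leq_sum.
have leY : K.*2.+1 * #|rpart G| <= edges_in (@edge G) setT setT.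
  by rewrite edges_in_degree_r mulnC -sum_nat_const leq_sum.
(* Counting the edges from both sides gives [K.*2.+1] times the number of vertices as a lower bound
   for twice their number, against the upper bound with [K.*2]. *)
have := leq_trans (leq_add leX leY) (leq_add leE leE).
by rewrite -mulnDr addnn doubleMl leq_pmul2r ?ltnn.
Qed.

(** * Orientations of bounded out-degree *)

Lemma card_induced_nbr (T : finType) (B : {set T}) (P : pred T) :
  #|[set y : {y : T | y \in B} | P (val y)]| = #|[set y in B | P y]|.
Proof.
rewrite -(card_imset _ val_inj); apply: eq_card => y; rewrite inE.
apply/imsetP/andP => [[z + ->]|[yB Py]]; first by rewrite inE (valP z).
by exists (exist _ y yB); rewrite ?inE.
Qed.

(** Vertices of low degree are removed one at a time; each takes its neighbours among the vertices
    still present as out-neighbours. *)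
Lemma low_outdegree_orientation (G : bigraph) (d : nat) :
  (forall (A : {set lpart G}) (B : {set rpart G}),
     0 < #|vertex (induced A B)| ->
     exists v : vertex (induced A B), degree v <= d) ->
  exists (f : lpart G -> {set rpart G}) (g : rpart G -> {set lpart G}),
    [/\ forall x, #|f x| <= d, forall y, #|g y| <= d &
        forall x y, edge x y = (y \in f x) || (x \in g y)].
Proof.
move=> degen.
(* Out-neighbours are required to be neighbours everywhere, while edges need only be covered within
   [A] and [B]; for [setT] the two give the equivalence. *)
suff main : forall (A : {set lpart G}) (B : {set rpart G}),
  exists (f : lpart G -> {set rpart G}) (g : rpart G -> {set lpart G}),
    [/\ forall x, #|f x| <= d /\ {in f x, forall y, edge x y},
        forall y, #|g y| <= d /\ {in g y, forall x, edge x y} &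
        {in A & B, forall x y, edge x y -> (y \in f x) || (x \in g y)}].
  have [f [g [hf hg hfg]]] := main setT setT; exists f, g; split.
  - by move=> x; case: (hf x).
  - by move=> y; case: (hg y).
  - move=> x y; apply/idP/orP => [/hfg h|[yf|xg]].
    + by apply/orP/h; rewrite inE.
    + by case: (hf x) => _; apply.
    + by case: (hg y) => _; apply.
move=> A B; have [N ltN] := ubnP (#|A| + #|B|).
elim: N A B ltN => // N IH A B; rewrite ltnS => leN.
have cI : #|vertex (induced A B)| = #|A| + #|B|.
  by rewrite card_sum !card_sig.
have [/eqP|] := posnP (#|A| + #|B|).
  rewrite addn_eq0 !cards_eq0 => /andP[/eqP-> _].
  exists (fun=> set0), (fun=> set0).
  by split=> [x|y|x y]; rewrite ?cards0 ?inE //; split=> // z; rewrite inE.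
rewrite -cI => /degen[[[x xA]|[y yB]]] /=.
  rewrite (card_induced_nbr B (edge x)) => led.
  have [|f [g [hf hg hfg]]] := IH (A :\ x) B.
    by rewrite (leq_trans _ leN) // [in leqRHS](cardsD1 x) xA -addnA.
  exists (fun z => if z == x then [set y in B | edge x y] else f z), g.
  split=> // [z|z y zA yB].
    by case: eqP => // ->; split=> // y; rewrite inE => /andP[].
  case: eqP => [->|/eqP zx]; first by rewrite inE yB => ->.
  by apply: hfg => //; rewrite !inE zx.
rewrite (card_induced_nbr A (fun x => edge x y)) => led.
have [|f [g [hf hg hfg]]] := IH A (B :\ y).
  by rewrite (leq_trans _ leN) // [in leqRHS](cardsD1 y) yB addnCA.
exists f, (fun z => if z == y then [set x in A | edge x y] else g z).
split=> // [z|x z xA zB].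
  by case: eqP => // ->; split=> // x; rewrite inE => /andP[].
case: eqP => [->|/eqP zy]; first by rewrite !inE xA => ->; rewrite orbT.
by apply: hfg => //; rewrite !inE zy.
Qed.

(** * Equality trees from orientations *)

Definition or_tree (X Y : Type) (qs : seq ((X -> nat) * (Y -> nat))) :
    eq_tree X Y :=
  foldr (fun q T => Node q.1 q.2 T (Leaf Plus)) (Leaf Minus) qs.

Lemma depth_or_tree (X Y : Type) (qs : seq ((X -> nat) * (Y -> nat))) :
  depth (or_tree qs) = size qs.
Proof. by elim: qs => //= q qs ->; rewrite maxn0. Qed.

Lemma eval_or_tree (X Y : Type) (qs : seq ((X -> nat) * (Y -> nat))) x y :
  eval (or_tree qs) x y = if has (fun q => q.1 x == q.2 y) qs then Plus else Minus.
Proof. by elim: qs => //= q qs ->; case: eqP. Qed.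

(* The codes are positive, so that 0 can stand for a missing i-th element. *)
Definition code (T : finType) (z : T) : nat := (enum_rank z).+1.

Definition code_nth (T : finType) (S : {set T}) (i : nat) : nat :=
  nth 0 (map (@code T) (enum S)) i.

(** Membership becomes [d] equality tests, each comparing a number depending only on [S] with one
    depending only on [z], as a query demands. *)
Lemma has_code_nth (T : finType) (S : {set T}) (d : nat) (z : T) :
  #|S| <= d -> has (fun i => code_nth S i == code z) (iota 0 d) = (z \in S).
Proof.
move=> leS; have code_inj : injective (@code T).
  by move=> u v [] /val_inj /enum_rank_inj.
rewrite -mem_enum -(mem_map code_inj); apply/hasP/idP => [[i _ /eqP ei]|zS].
  rewrite -ei mem_nth // ltnNge; apply/negP => le_i.
  by move: ei; rewrite /code_nth nth_default.
exists (index (code z) (map (@code T) (enum S))); last first.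
  by rewrite /code_nth nth_index.
rewrite mem_iota /= add0n; apply: leq_trans leS.
by rewrite cardE -(size_map (@code T)) index_mem.
Qed.

Lemma DEq_orientation (G : bigraph) (d : nat)
    (f : lpart G -> {set rpart G}) (g : rpart G -> {set lpart G}) :
  (forall x, #|f x| <= d) -> (forall y, #|g y| <= d) ->
  (forall x y, edge x y = (y \in f x) || (x \in g y)) ->
  DEq (@Adj G) <= d + d.
Proof.
move=> lef leg efg.
(* The first [d] queries ask whether [y] is the [i]-th out-neighbour of [x], the others whether [x]
   is that of [y]. *)
pose qs : seq ((lpart G -> nat) * (rpart G -> nat)) :=
  [seq (fun x => code_nth (f x) i, @code _) | i <- iota 0 d] ++
  [seq (@code _, fun y => code_nth (g y) i) | i <- iota 0 d].
have <- : depth (or_tree qs) = d + d.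
  by rewrite depth_or_tree size_cat !size_map size_iota.
apply: DEq_le => x y; rewrite eval_or_tree has_cat !has_map /Adj efg.
rewrite -(has_code_nth y (lef x)) -(has_code_nth x (leg y)) /=.
congr (if _ || _ then _ else _); apply: eq_has => i //=.
Qed.

Theorem theorem1p5 (C : bigraph -> Prop) (isoC : iso_closed C)
    (herC : hereditary C) (sparseC : weakly_sparse C) :
  DEq_bounded C <-> bounded_degeneracy C.
Proof.
split=> [[c leC]|[d degC]].
  have [t freeC] := sparseC.
  (* The depth varies with [G] up to [c]; the maximum covers every value without monotonicity of
     [tree_bound]. *)
  exists (\max_(k < c.+1) tree_bound t k 0).*2 => G CG.
  apply: exists_low_degree; apply: leq_trans (card_edges_le (freeC G CG)) _.
  have ltc : DEq (@Adj G) < c.+1 by rewrite ltnS leC.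
  by rewrite leq_mul2r (leq_bigmax (Ordinal ltc)) orbT.
exists (d + d) => G CG.
have [A B|f [g [lef leg efg]]] := @low_outdegree_orientation G d.
  (* Heredity turns the low-degree vertex of members of [C] into one in every nonempty induced
     subgraph of [G]. *)
  exact/degC/herC.
exact: DEq_orientation lef leg efg.
Qed.
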